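(* Let $\Phi=(A;\{E_i\}_{i=0}^d;A^*;\{E^*_i\}_{i=0}^d)$ be a tridiagonal system on $V$ with diameter $d\geq 1$ that has $q$-Serre type, and regard $V$ as a $U^+_q$-module on which $W_0$ acts as $A$ and $W_1$ acts as $A^*$. Let $\{\mathcal V_i\}_{i=0}^d$ be one of the six decompositions of $V$ listed below (with $\mathcal V_{-1}=\mathcal V_{d+1}=0$). Then for all $k\in\mathbb N$ and $0\leq i\leq d$: (a) for $[0,D]$, $[0^*,D^*]$ and $[0^*,D]$: $G_{k+1}\mathcal V_i\subseteq\mathcal V_{i-1}+\mathcal V_i$ and $\tilde G_{k+1}\mathcal V_i\subseteq \mathcal V_i+\mathcal V_{i+1}$; (b) for $[0^*,0]$: $G_{k+1}\mathcal V_i\subseteq \mathcal V_i$ and $\tilde G_{k+1}\mathcal V_i\subseteq\mathcal V_{i-1}+\mathcal V_i+\mathcal V_{i+1}$; (c) for $[D^*,0]$: $G_{k+1}\mathcal V_i\subseteq \mathcal V_i+\mathcal V_{i+1}$ and $\tilde G_{k+1}\mathcal V_i\subseteq\mathcal V_{i-1}+\mathcal V_i$; (d) for $[D^*,D]$: $G_{k+1}\mathcal V_i\subseteq \mathcal V_{i-1}+\mathcal V_i+\mathcal V_{i+1}$ and $\tilde G_{k+1}\mathcal V_i\subseteq\mathcal V_i$.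
   Context: $\mathbb F$ is a field, $V$ a nonzero finite-dimensional $\mathbb F$-vector space. A tridiagonal (TD) pair on $V$ is an ordered pair $A,A^*\in\mathrm{End}(V)$ such that: (i) each of $A,A^*$ is diagonalizable; (ii) there is an ordering $\{V_i\}_{i=0}^d$ of the eigenspaces of $A$ with $A^*V_i\subseteq V_{i-1}+V_i+V_{i+1}$ ($V_{-1}=V_{d+1}=0$); (iii) there is an ordering $\{V^*_i\}_{i=0}^\delta$ of the eigenspaces of $A^*$ with $AV^*_i\subseteq V^*_{i-1}+V^*_i+V^*_{i+1}$; (iv) there is no subspace $W\neq 0,V$ with $AW\subseteq W$, $A^*W\subseteq W$. Such orderings are called standard. A TD system on $V$ is a sequence $(A;\{E_i\}_{i=0}^d;A^*;\{E^*_i\}_{i=0}^\delta)$ where $A,A^*$ is a TD pair, $\{E_i\}$ are the primitive idempotents of $A$ in a standard ordering and $\{E^*_i\}$ those of $A^*$ in a standard ordering; one always has $d=\delta$ (the diameter). Let $\theta_i$ (resp. $\theta^*_i$) be the eigenvalue of $A$ for $E_i$ (resp. of $A^*$ for $E^*_i$). Fix a nonzero $q$ in the algebraic closure of $\mathbb F$, not a root of unity, with $b=q^2\in\mathbb F$. $\Phi$ has $q$-Serre type if $\theta_i=b\theta_{i-1}$ and $\theta^*_i=b^{-1}\theta^*_{i-1}$ for $1\leq i\leq d$. $U^+_q$ is the $\mathbb F$-algebra with generators $W_0,W_1$ and relations $[W_0,[W_0,[W_0,W_1]_b]_{b^{-1}}]=0$, $[W_1,[W_1,[W_1,W_0]_b]_{b^{-1}}]=0$,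 where $[X,Y]=XY-YX$ and $[X,Y]_b=bXY-YX$. When $\Phi$ has $q$-Serre type, $A,A^*$ satisfy these relations, so $V$ is a $U^+_q$-module with $W_0\mapsto A$, $W_1\mapsto A^*$. The alternating elements $W_{-k},W_{k+1},G_{k+1},\tilde G_{k+1}$ ($k\in\mathbb N$) of $U^+_q$ are defined recursively, in the order $W_0,W_1,G_1,\tilde G_1,W_{-1},W_2,G_2,\tilde G_2,\dots$, with $G_0=\tilde G_0=1$, by: for $n\geq1$, $G_n=\frac{\sum_{k=0}^{n-1}W_{-k}W_{n-k}b^{-k}-\sum_{k=1}^{n-1}G_k\tilde G_{n-k}b^{-k}}{1+b^{-n}}+\frac{[W_n,W_0]}{(1+b^{-n})(1-b^{-1})}$, $\tilde G_n=G_n+\frac{[W_0,W_n]}{1-b^{-1}}$, $W_{-n}=\frac{[W_0,G_n]_b}{b-1}$, $W_{n+1}=\frac{[G_n,W_1]_b}{b-1}$. The six decompositions of $V$ have $i$-th components: $[0,D]$: $E_iV$; $[0^*,D^*]$: $E^*_iV$; $[0^*,0]$: $(E^*_0V+\cdots+E^*_iV)\cap(E_0V+\cdots+E_{d-i}V)$; $[0^*,D]$: $(E^*_0V+\cdots+E^*_iV)\cap(E_iV+\cdots+E_dV)$; $[D^*,0]$: $(E^*_{d-i}V+\cdots+E^*_dV)\cap(E_0V+\cdots+E_{d-i}V)$; $[D^*,D]$: $(E^*_{d-i}V+\cdots+E^*_dV)\cap(E_iV+\cdots+E_dV)$. *)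

(* Defs.v *)
From HB Require Import structures.
From mathcomp Require Import all_boot all_order all_algebra.
From mathcomp Require Import finmap boolp.
From mathcomp.multinomials Require Import monalg.

Set Implicit Arguments.
Unset Strict Implicit.
Unset Printing Implicit Defensive.

Import GRing.Theory.

Local Open Scope ring_scope.
Local Open Scope quotient_scope.

Section Commutators.
Variables (F : fieldType) (U : lalgType F).
Implicit Types (b : F) (X Y : U).

Definition comm X Y : U := X * Y - Y * X.
Definition qcomm b X Y : U := b *: (X * Y) - Y * X.

End Commutators.

(* The free algebra F<W_0, W_1> is the monoid algebra of the free monoid on
   the two letters false (for W_0) and true (for W_1). *)
Notation free_alg F := {malg F[{fmonom bool}]}.

Definition free_gen (F : fieldType) (i : bool) : free_alg F := << fmu i >>.

(* The library only declares the left algebra structure of free_alg F. *)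
Lemma free_alg_scalerAr (F : fieldType) (a : F) (x y : free_alg F) :
  a *: (x * y) = x * (a *: y).
Proof.
apply/malgP=> k; rewrite mcoeffZ mcoeffMl.
rewrite (mcoeffMlw _ (fsubset_refl _) (msuppZ_le _ _)) mulr_sumr.
apply: eq_bigr => i _; rewrite mulr_sumr; apply: eq_bigr => j _.
by rewrite mcoeffZ mulrnAr mulrCA.
Qed.

Section UqPlus.
Variables (F : fieldType) (b : F).

Local Notation R := (free_alg F).

Definition serre_rel (i : bool) : R :=
  let X := free_gen F i in let Y := free_gen F (~~ i) in
  comm X (qcomm b^-1 X (qcomm b X Y)).

Definition in_serre_ideal (x : R) : Prop :=
  exists s : seq (R * bool * R),
    x = \sum_(t <- s) t.1.1 * serre_rel t.1.2 * t.2.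

Definition serre_ideal (x : R) : bool := `[< in_serre_ideal x >].

Fact serre_ideal_zmod_closed : zmod_closed serre_ideal.
Proof.
split; first by apply/asboolP; exists [::]; rewrite big_nil.
move=> _ _ /asboolP[s ->] /asboolP[t ->]; apply/asboolP.
exists (s ++ [seq (- r.1.1, r.1.2, r.2) | r <- t]).
rewrite big_cat big_map /=; congr (_ + _).
by rewrite -sumrN; apply: eq_bigr => r _; rewrite !mulNr.
Qed.

HB.instance Definition _ :=
  GRing.isZmodClosed.Build R serre_ideal serre_ideal_zmod_closed.

Lemma serre_idealMl (a x : R) : x \in serre_ideal -> a * x \in serre_ideal.
Proof.
move=> /asboolP[s ->]; apply/asboolP.
exists [seq (a * r.1.1, r.1.2, r.2) | r <- s].
by rewrite big_map mulr_sumr; apply: eq_bigr => r _; rewrite !mulrA.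
Qed.

Lemma serre_idealMr (a x : R) : x \in serre_ideal -> x * a \in serre_ideal.
Proof.
move=> /asboolP[s ->]; apply/asboolP.
exists [seq (r.1.1, r.1.2, r.2 * a) | r <- s].
by rewrite big_map mulr_suml; apply: eq_bigr => r _; rewrite !mulrA.
Qed.

(* The constant coefficient is a ring morphism that kills both relations. *)
Lemma serre_ideal1 : 1 \notin serre_ideal.
Proof.
apply/negP => /asboolP[s].
pose e : {rmorphism {malg F[{fmonom bool}]} -> F} := mcoeff mone.
have eg i : e (free_gen F i) = 0.
  rewrite /e /= mcoeffU; case: eqP => // /eqP.
  by rewrite fmP /mone /= !(fmuE, fmoneE).
move=> /(congr1 e) /eqP; rewrite rmorph1 rmorph_sum big1 ?oner_eq0 //.
move=> [[x i] y] _; rewrite !rmorphM /=; suff -> : e (serre_rel i) = 0.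
  by rewrite mulr0 mul0r.
by rewrite /serre_rel /comm rmorphB !rmorphM eg mul0r mulr0 subrr.
Qed.

Definition serre_idealZ : zmodClosed R :=
  GRing.ZmodClosed.clone R serre_ideal _.

(* U_q^+: the quotient of the free algebra by the two-sided ideal generated by
   the two q-Serre relations. *)
Definition Uqp : Type := {ideal_quot serre_idealZ}.

HB.instance Definition _ := GRing.Zmodule.on Uqp.
HB.instance Definition _ := EqQuotient.on Uqp.

Let pr (x : R) : Uqp := \pi_Uqp x.

Let prP (x y : R) : reflect (pr x = pr y) (x - y \in serre_ideal).
Proof. by have := @eqquotP _ _ Uqp x y; rewrite Quotient.equivE. Qed.

Let prD (x y : R) : pr (x + y) = pr x + pr y.
Proof. by rewrite /pr !piE. Qed.

Let prK (x : Uqp) : pr (repr x) = x.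
Proof. exact: reprK. Qed.

Definition Uqp_one : Uqp := pr 1.
Definition Uqp_mul (x y : Uqp) : Uqp := pr (repr x * repr y).
Definition Uqp_scale (a : F) (x : Uqp) : Uqp := pr (a *: repr x).

Let prM (x y : R) : Uqp_mul (pr x) (pr y) = pr (x * y).
Proof.
apply/prP; set x' := repr _; set y' := repr _.
rewrite -(subrKA (x' * y)) -mulrBr -mulrBl rpredD //.
  by apply: serre_idealMl; apply/prP; rewrite prK.
by apply: serre_idealMr; apply/prP; rewrite prK.
Qed.

Let prZ (a : F) (x : R) : Uqp_scale a (pr x) = pr (a *: x).
Proof.
apply/prP; rewrite -scalerBr -[_ - _]mul1r scalerAl.
by apply: serre_idealMl; apply/prP; rewrite prK.
Qed.

Fact Uqp_mulA : associative Uqp_mul.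
Proof. by move=> x y z; rewrite -[x]prK -[y]prK -[z]prK !prM mulrA. Qed.

Fact Uqp_mul1 : left_id Uqp_one Uqp_mul.
Proof. by move=> x; rewrite -[x]prK prM mul1r. Qed.

Fact Uqp_mulr1 : right_id Uqp_one Uqp_mul.
Proof. by move=> x; rewrite -[x]prK prM mulr1. Qed.

Fact Uqp_mulDl : left_distributive Uqp_mul +%R.
Proof.
by move=> x y z; rewrite -[x]prK -[y]prK -[z]prK -prD !prM -prD mulrDl.
Qed.

Fact Uqp_mulDr : right_distributive Uqp_mul +%R.
Proof.
by move=> x y z; rewrite -[x]prK -[y]prK -[z]prK -prD !prM -prD mulrDr.
Qed.

Fact Uqp_one_neq0 : Uqp_one != 0.
Proof.
have -> : 0 = pr 0 by rewrite /pr piE.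
by apply/eqP => /prP; rewrite subr0; apply/negP; exact: serre_ideal1.
Qed.

HB.instance Definition _ := GRing.Zmodule_isNzRing.Build Uqp
  Uqp_mulA Uqp_mul1 Uqp_mulr1 Uqp_mulDl Uqp_mulDr Uqp_one_neq0.

Fact Uqp_scaleA a c (x : Uqp) :
  Uqp_scale a (Uqp_scale c x) = Uqp_scale (a * c) x.
Proof. by rewrite -[x]prK !prZ scalerA. Qed.

Fact Uqp_scale1 : left_id 1 Uqp_scale.
Proof. by move=> x; rewrite -[x]prK prZ scale1r. Qed.

Fact Uqp_scaleDr : right_distributive Uqp_scale +%R.
Proof. by move=> a x y; rewrite -[x]prK -[y]prK -prD !prZ -prD scalerDr. Qed.

Fact Uqp_scaleDl (x : Uqp) : {morph Uqp_scale^~ x : a c / a + c}.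
Proof. by move=> a c; rewrite -[x]prK !prZ -prD scalerDl. Qed.

HB.instance Definition _ := GRing.Zmodule_isLmodule.Build F Uqp
  Uqp_scaleA Uqp_scale1 Uqp_scaleDr Uqp_scaleDl.

Fact Uqp_scaleAl (a : F) (x y : Uqp) : a *: (x * y) = (a *: x) * y.
Proof.
rewrite -[x]prK -[y]prK; change (Uqp_scale a (Uqp_mul (pr (repr x)) (pr (repr y)))
  = Uqp_mul (Uqp_scale a (pr (repr x))) (pr (repr y))).
by rewrite prZ !prM prZ scalerAl.
Qed.

HB.instance Definition _ := GRing.Lmodule_isLalgebra.Build F Uqp Uqp_scaleAl.

Fact Uqp_scaleAr (a : F) (x y : Uqp) : a *: (x * y) = x * (a *: y).
Proof.
rewrite -[x]prK -[y]prK; change (Uqp_scale a (Uqp_mul (pr (repr x)) (pr (repr y)))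
  = Uqp_mul (pr (repr x)) (Uqp_scale a (pr (repr y)))).
by rewrite prZ !prM prZ free_alg_scalerAr.
Qed.

HB.instance Definition _ := GRing.Lalgebra_isAlgebra.Build F Uqp Uqp_scaleAr.

Definition W0 : Uqp := \pi_Uqp (free_gen F false).
Definition W1 : Uqp := \pi_Uqp (free_gen F true).

End UqPlus.

Section AlternatingElements.
(* The recursion makes sense in any algebra U with two chosen elements W0, W1;
   the alternating elements of U_q^+ are the case U = Uqp b below. *)
Variables (F : fieldType) (U : algType F) (b : F) (W0 W1 : U).

(* The n-th block: W_{-n}, W_{n+1}, G_n, Gt_n. *)
Record alt_block := AltBlock { blkWm : U; blkWp : U; blkG : U; blkGt : U }.

(* The n-th block (n > 0), given the earlier ones h 0, ..., h (n - 1). *)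
Definition alt_next (h : nat -> alt_block) (n : nat) : alt_block :=
  let Wn := blkWp (h n.-1) in
  let g :=
    (1 + b ^- n)^-1 *:
      (\sum_(0 <= k < n) b ^- k *: (blkWm (h k) * blkWp (h (n - k).-1))
       - \sum_(1 <= k < n) b ^- k *: (blkG (h k) * blkGt (h (n - k)%N)))
    + ((1 + b ^- n) * (1 - b^-1))^-1 *: comm Wn W0 in
  {| blkWm := (b - 1)^-1 *: qcomm b W0 g;
     blkWp := (b - 1)^-1 *: qcomm b g W1;
     blkG := g;
     blkGt := g + (1 - b^-1)^-1 *: comm W0 Wn |}.

Fixpoint alt_history (n : nat) : nat -> alt_block :=
  if n is n'.+1 then
    fun k => if (k <= n')%N then alt_history n' k
             else alt_next (alt_history n') n
  else fun=> {| blkWm := W0; blkWp := W1; blkG := 1; blkGt := 1 |}.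

Definition alt_blk (n : nat) : alt_block := alt_history n n.

(* altWm n is W_{-n} and, for n > 0, altWp n is W_n. *)
Definition altWm (n : nat) : U := blkWm (alt_blk n).
Definition altWp (n : nat) : U := blkWp (alt_blk n.-1).
Definition altG (n : nat) : U := blkG (alt_blk n).
Definition altGt (n : nat) : U := blkGt (alt_blk n).

Lemma alt_history_blk n k : (k <= n)%N -> alt_history n k = alt_blk k.
Proof.
elim: n => [|n IHn]; first by case: k.
rewrite leq_eqVlt => /predU1P[-> //|]; rewrite ltnS => le_kn /=.
by rewrite le_kn IHn.
Qed.

Lemma alt_blkS n : (0 < n)%N -> alt_blk n = alt_next alt_blk n.
Proof.
case: n => // n _; rewrite [LHS]/alt_blk /= ltnn /alt_next /=.
rewrite alt_history_blk //.
have -> : \sum_(0 <= k < n.+1) b ^- k *: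
    (blkWm (alt_history n k) * blkWp (alt_history n (n.+1 - k).-1))
  = \sum_(0 <= k < n.+1) b ^- k *:
    (blkWm (alt_blk k) * blkWp (alt_blk (n.+1 - k).-1)).
  apply: eq_big_nat => k /andP[_]; rewrite ltnS => le_kn.
  by rewrite !alt_history_blk // subSn //= leq_subr.
have -> // : \sum_(1 <= k < n.+1) b ^- k *:
    (blkG (alt_history n k) * blkGt (alt_history n (n.+1 - k)%N))
  = \sum_(1 <= k < n.+1) b ^- k *:
    (blkG (alt_blk k) * blkGt (alt_blk (n.+1 - k)%N)).
apply: eq_big_nat => k /andP[k_gt0]; rewrite ltnS => le_kn.
by rewrite !alt_history_blk // leq_subLR -add1n leq_add2r.
Qed.

Lemma alt0 : [/\ altWm 0 = W0, altWp 1 = W1, altG 0 = 1 & altGt 0 = 1].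
Proof. by []. Qed.

Lemma altGE n : (0 < n)%N ->
  altG n =
    (1 + b ^- n)^-1 *:
      (\sum_(0 <= k < n) b ^- k *: (altWm k * altWp (n - k))
       - \sum_(1 <= k < n) b ^- k *: (altG k * altGt (n - k)))
    + ((1 + b ^- n) * (1 - b^-1))^-1 *: comm (altWp n) W0.
Proof. by move=> n_gt0; rewrite {1}/altG alt_blkS. Qed.

Lemma altGtE n : (0 < n)%N ->
  altGt n = altG n + (1 - b^-1)^-1 *: comm W0 (altWp n).
Proof. by move=> n_gt0; rewrite /altGt /altG alt_blkS. Qed.

Lemma altWmE n : (0 < n)%N ->
  altWm n = (b - 1)^-1 *: qcomm b W0 (altG n).
Proof. by move=> n_gt0; rewrite /altWm /altG alt_blkS. Qed.

Lemma altWpE n : (0 < n)%N ->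
  altWp n.+1 = (b - 1)^-1 *: qcomm b (altG n) W1.
Proof. by move=> n_gt0; rewrite /altWp /altG alt_blkS. Qed.

End AlternatingElements.

Definition Uqp_G (F : fieldType) (b : F) (n : nat) : Uqp b :=
  altG b (W0 b) (W1 b) n.
Definition Uqp_Gt (F : fieldType) (b : F) (n : nat) : Uqp b :=
  altGt b (W0 b) (W1 b) n.

Section TridiagonalSystems.
Variables (F : fieldType) (V : vectType F).
Implicit Types (A B X : 'End(V)) (d : nat).

Section Families.
Variable d : nat.
Implicit Types (S : 'I_d.+1 -> {vspace V}) (E : 'I_d.+1 -> 'End(V)).

(* S_{i-1} and S_{i+1}, with the convention S_{-1} = S_{d+1} = 0 *)
Definition sp_pred S (i : 'I_d.+1) : {vspace V} :=
  (\sum_(j < d.+1 | j.+1 == i) S j)%VS.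
Definition sp_succ S (i : 'I_d.+1) : {vspace V} :=
  (\sum_(j < d.+1 | j == i.+1 :> nat) S j)%VS.

Definition acts_diag X S := forall i, (X @: S i <= S i)%VS.
Definition acts_lower X S := forall i, (X @: S i <= sp_pred S i + S i)%VS.
Definition acts_raise X S := forall i, (X @: S i <= S i + sp_succ S i)%VS.
Definition acts_tridiag X S :=
  forall i, (X @: S i <= sp_pred S i + S i + sp_succ S i)%VS.

Definition eigenspace_ordering A S : Prop :=
  [/\ injective S,
      forall i, exists2 a, passmx.leigenvalue A a & S i = passmx.leigenspace A a
    & forall a, passmx.leigenvalue A a -> exists i, S i = passmx.leigenspace A a].

Definition standard_ordering A B S : Prop :=
  eigenspace_ordering A S /\ acts_tridiag B S.

Definition primitive_idempotents S E : Prop :=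
  forall i v, (v \in S i -> E i v = v) /\
              (forall j, j != i -> v \in S j -> E i v = 0).

End Families.

Definition lfun_diagonalizable A : Prop :=
  exists s : seq F, (\sum_(a <- s) passmx.leigenspace A a)%VS = fullv.

Record TD_pair A B : Prop := {
  TD_diagl : lfun_diagonalizable A;
  TD_diagr : lfun_diagonalizable B;
  TD_ordl : exists d (S : 'I_d.+1 -> {vspace V}), standard_ordering A B S;
  TD_ordr : exists d (S : 'I_d.+1 -> {vspace V}), standard_ordering B A S;
  TD_irr : forall W : {vspace V},
    (A @: W <= W)%VS -> (B @: W <= W)%VS -> W = 0%VS \/ W = fullv
}.

Section Systems.
Variable d : nat.
Implicit Types (E Es : 'I_d.+1 -> 'End(V)).

Record TD_system A E B Es : Prop := {
  TD_sys_pair : TD_pair A B;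
  TD_sys_idem : exists2 S, standard_ordering A B S & primitive_idempotents S E;
  TD_sys_dual : exists2 S, standard_ordering B A S & primitive_idempotents S Es
}.

(* a is the eigenvalue of A for the primitive idempotent P. *)
Definition eigenvalue_for A (P : 'End(V)) (a : F) : Prop :=
  passmx.leigenvalue A a /\ limg P = passmx.leigenspace A a.

Definition q_Serre_type (b : F) (theta thetas : 'I_d.+1 -> F) : Prop :=
  forall i j : 'I_d.+1, j = i.+1 :> nat ->
    theta j = b * theta i /\ thetas j = b^-1 * thetas i.

Definition sum_le E (i : nat) : {vspace V} :=
  (\sum_(j < d.+1 | (j <= i)%N) limg (E j))%VS.
Definition sum_ge E (i : nat) : {vspace V} :=
  (\sum_(j < d.+1 | (i <= j)%N) limg (E j))%VS.

Variables E Es : 'I_d.+1 -> 'End(V).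

Definition dec_0_D (i : 'I_d.+1) : {vspace V} := limg (E i).
Definition dec_0s_Ds (i : 'I_d.+1) : {vspace V} := limg (Es i).
Definition dec_0s_0 (i : 'I_d.+1) : {vspace V} :=
  (sum_le Es i :&: sum_le E (d - i))%VS.
Definition dec_0s_D (i : 'I_d.+1) : {vspace V} :=
  (sum_le Es i :&: sum_ge E i)%VS.
Definition dec_Ds_0 (i : 'I_d.+1) : {vspace V} :=
  (sum_ge Es (d - i) :&: sum_le E (d - i))%VS.
Definition dec_Ds_D (i : 'I_d.+1) : {vspace V} :=
  (sum_ge Es (d - i) :&: sum_ge E i)%VS.

End Systems.

(* A left U-module structure on V extending the scalar action, presented as
   the algebra homomorphism U -> End(V).  Products go to composites f \o g;
   the ring structure on 'End(V) in the library has the opposite product. *)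
Definition alg_module (U : algType F) (rho : U -> 'End(V)) : Prop :=
  [/\ linear rho, rho 1 = \1%VF
    & forall x y, rho (x * y) = (rho x \o rho y)%VF].

End TridiagonalSystems.

(* Main.v *)
(* Write W^-(t), W^+(t), G(t), Gt(t) for the generating functions of W_{-n},
   W_{n+1}, G_n and the second G-family.  The recursion says that
     G(t/b) Gt(t) - t W^-(t/b) W^+(t) = 1,
     (1 - 1/b) (Gt - G) = t [W_0, W^+],
     (b-1) W^- = [W_0, G]_b   and   (b-1) W^+ = [G, W_1]_b.
   Induction on the degree shows that moreover
     (b-1) W^- = [Gt, W_0]_b,  (b-1) W^+ = [W_1, Gt]_b,
     [W_0, W^-] = 0 = [W_1, W^+],
   carrying along the fused relations G(t/b) W^-(t) = W^-(t/b) G(t) and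
   Gt(t/b) W^+(t) = W^+(t/b) Gt(t).  Moving W_1 through the former and W_0
   through the latter gives the second determinant
     Gt(t/b) G(t) - t W^+(t/b) W^-(t) = 1.
   Commuting W_0 with both determinants gives two linear equations for the
   possible failure f of the degree n relations, whose combination is
   (1 + b^-n) f = 0; likewise for W_1.

   On V these relations become quadratic in A or A^* with roots two
   consecutive eigenvalues: G_n lowers and Gt_n raises both eigenspace
   decompositions by at most one.  The remaining four decompositions follow
   by intersecting flags, because (E*_0 V + ... + E*_i V) and
   (E_j V + ... + E_d V) meet in the span of the components with indices in
   [j, i] (Ito, Tanabe and Terwilliger). *)

Require Import Defs.
From mathcomp Require Import all_boot all_order all_algebra.
From mathcomp Require Import finmap boolp.
From mathcomp.multinomials Require Import monalg.
From mathcomp Require Import ring zify.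

Import GRing.Theory.
Local Open Scope ring_scope.

Section SkewCommutation.
Set Implicit Arguments.
Unset Strict Implicit.
Variables (F : fieldType) (U : algType F).
Implicit Types (x z u : U) (a b : F) (f : nat -> U).

Definition skew x a z u : Prop := x * z = a *: (z * x) + u.

Lemma skewM x a a' z z' u u' :
  skew x a z u -> skew x a' z' u' ->
  skew x (a * a') (z * z') (a *: (z * u') + u * z').
Proof.
rewrite /skew => xz xz'.
rewrite mulrA xz mulrDl -scalerAl -[z * x * _]mulrA xz' mulrDr scalerDr -scalerAr.
by rewrite scalerA mulrA addrA.
Qed.

Lemma skewZ x a e z u : skew x a z u -> skew x a (e *: z) (e *: u).
Proof.
by rewrite /skew => xz; rewrite -scalerAr xz scalerDr -scalerAl !scalerA mulrC.
Qed.

Lemma skew_sum x a n (z u : 'I_n -> U) :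
  (forall i, skew x a (z i) (u i)) -> skew x a (\sum_i z i) (\sum_i u i).
Proof.
move=> xz; rewrite /skew mulr_sumr mulr_suml scaler_sumr -big_split.
by apply: eq_bigr => i _; apply: xz.
Qed.

Lemma skew_inj x a z z' u u' :
  skew x a z u -> skew x a z' u' -> z = z' -> u = u'.
Proof. by rewrite /skew => + + zz'; rewrite zz' => -> /addrI. Qed.

Lemma skew1P x z : skew x 1 z 0 <-> x * z = z * x.
Proof. by rewrite /skew scale1r addr0. Qed.

(* The coefficient of t^n in f(t/b) f'(t), for the generating functions of f
   and f'. *)
Definition conv b n f f' : U :=
  \sum_(k < n.+1) b ^- k *: (f k * f' (n - k)%N).

Variable b : F.
Implicit Types n N : nat.

Lemma eq_conv n f1 f2 f1' f2' :
  (forall k, (k <= n)%N -> f1 k = f2 k) ->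
  (forall k, (k <= n)%N -> f1' k = f2' k) ->
  conv b n f1 f1' = conv b n f2 f2'.
Proof.
move=> e e'; apply: eq_bigr => i _.
by rewrite e ?e' ?leq_subr // -ltnS.
Qed.

Lemma convZl n a f f' : conv b n (fun k => a *: f k) f' = a *: conv b n f f'.
Proof.
rewrite scaler_sumr; apply: eq_bigr => i _.
by rewrite -scalerAl !scalerA mulrC.
Qed.

Lemma convZr n a f f' : conv b n f (fun k => a *: f' k) = a *: conv b n f f'.
Proof.
rewrite scaler_sumr; apply: eq_bigr => i _.
by rewrite -scalerAr !scalerA mulrC.
Qed.

Lemma convBl n f1 f2 f' :
  conv b n (fun k => f1 k - f2 k) f' = conv b n f1 f' - conv b n f2 f'.
Proof.
rewrite -sumrB; apply: eq_bigr => i _.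
by rewrite mulrBl scalerBr.
Qed.

Lemma convBr n f f1' f2' :
  conv b n f (fun k => f1' k - f2' k) = conv b n f f1' - conv b n f f2'.
Proof.
rewrite -sumrB; apply: eq_bigr => i _.
by rewrite mulrBr scalerBr.
Qed.

Lemma conv0l n f' : conv b n (fun=> 0) f' = 0.
Proof. by rewrite /conv big1 // => i _; rewrite mul0r scaler0. Qed.

Lemma conv0r n f : conv b n f (fun=> 0) = 0.
Proof. by rewrite /conv big1 // => i _; rewrite mulr0 scaler0. Qed.

Lemma conv_shiftr N f f' : f' 0 = 0 ->
  conv b N f (fun k => f' k.+1) = conv b N.+1 f f'.
Proof.
move=> f'0; rewrite [RHS]/conv big_ord_recr /= subnn f'0 mulr0 scaler0 addr0.
by apply: eq_bigr => i _; rewrite subSn // -ltnS.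
Qed.

Lemma conv_shiftl N f f' : b != 0 -> f 0 = 0 ->
  conv b N (fun k => f k.+1) f' = b *: conv b N.+1 f f'.
Proof.
move=> b0 f0; rewrite [X in _ = b *: X]/conv big_ord_recl /= f0 mul0r scaler0.
rewrite add0r scaler_sumr; apply: eq_bigr => i _.
by rewrite scalerA /bump /= add1n subSS exprS invfM mulVKf.
Qed.

Lemma conv_topl n f1 f2 f' :
  (forall k, (k < n)%N -> f1 k = f2 k) ->
  conv b n f1 f' - conv b n f2 f' = b ^- n *: ((f1 n - f2 n) * f' 0).
Proof.
move=> e; rewrite -convBl /conv big_ord_recr big1 /= ?add0r ?subnn //.
by move=> i _; rewrite e // subrr mul0r scaler0.
Qed.

Lemma conv_topr n f f1' f2' :
  (forall k, (k < n)%N -> f1' k = f2' k) ->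
  conv b n f f1' - conv b n f f2' = f 0 * (f1' n - f2' n).
Proof.
move=> e; rewrite -convBr /conv big_ord_recl big1 /= => [|i _].
  by rewrite addr0 subn0 expr0 invr1 scale1r.
rewrite e ?subrr ?mulr0 ?scaler0 //.
by rewrite /bump /= add1n ltn_subrL /= (leq_ltn_trans (leq0n i) (ltn_ord i)).
Qed.

Lemma skew_conv x a a' n f r f' r' :
  (forall k, (k <= n)%N -> skew x a (f k) (r k)) ->
  (forall k, (k <= n)%N -> skew x a' (f' k) (r' k)) ->
  skew x (a * a') (conv b n f f') (a *: conv b n f r' + conv b n r f').
Proof.
move=> xf xf'; rewrite /conv scaler_sumr -big_split.
apply: skew_sum => i /=.
have -> : a *: (b ^- i *: (f i * r' (n - i)%N)) + b ^- i *: (r i * f' (n - i)%N)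
  = b ^- i *: (a *: (f i * r' (n - i)%N) + r i * f' (n - i)%N).
  by rewrite [RHS]scalerDr !scalerA mulrC.
apply: skewZ; apply: skewM; [apply: xf | apply: xf'].
  by rewrite -ltnS.
exact: leq_subr.
Qed.

End SkewCommutation.

Section InductionStep.
Set Implicit Arguments.
Unset Strict Implicit.
Variables (F : fieldType) (U : algType F) (b : F).
Hypotheses (b0 : b != 0) (b1 : forall n, b ^+ n.+1 != 1).
Let c : F := 1 - b^-1.

Let c0 : c != 0.
Proof. by have := b1 0; rewrite subr_eq0 [1 == _]eq_sym invr_eq1 expr1. Qed.

Variable x : U.
Implicit Types g h m p : nat -> U.

Lemma conv_commute h m p D N :
  (forall k, (k <= N)%N -> skew x b (h k) (- (b * c) *: m k)) ->
  (forall k, (k <= N)%N -> skew x 1 (p k) (c *: D k.+1)) ->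
  D 0 = 0 ->
  conv b N h p = conv b N p h ->
  conv b N.+1 h D - conv b N.+1 D h = conv b N m p - conv b N p m.
Proof.
move=> xh xp D0 E.
have S := skew_conv b xp xh; rewrite [1 * b]mulrC in S.
have := skew_inj (skew_conv b xh xp) S E.
rewrite !(convZl, convZr) conv_shiftr // conv_shiftl // scale1r !scalerA.
rewrite [c * b]mulrC !scaleNr => X.
apply: (scalerI (mulf_neq0 b0 c0)); rewrite !scalerBr.
by apply/eqP; rewrite subr_eq -addrA -X addrC subrK.
Qed.

(* Applied with m' the other candidate for the sequence m, which is only known
   to agree with m up to N; h - g plays the role of a commutator of x and p. *)
Lemma fused_determinants g h m m' p N :
  g 0 = 1 -> h 0 = 1 ->
  (forall k, (k <= N.+1)%N -> skew x b^-1 (g k) (c *: m k)) ->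
  (forall k, (k <= N.+1)%N -> skew x b (h k) (- (b * c) *: m' k)) ->
  (forall k, (k <= N)%N -> m' k = m k) ->
  (forall k, (k <= N)%N -> skew x 1 (m k) 0) ->
  (forall k, (k <= N)%N -> skew x 1 (p k) (c *: (h k.+1 - g k.+1))) ->
  1 + b ^- N.+1 != 0 ->
  conv b N.+1 g h = conv b N m p ->
  conv b N.+1 h g = conv b N p m ->
  m' N.+1 = m N.+1 /\ conv b N.+1 g m = conv b N.+1 m g.
Proof.
move=> g0 h0 xg xh m'm xm xp bN Z1 Z2; pose D k := h k - g k.
have D0 : D 0 = 0 by rewrite /D g0 h0 subrr.
have E1 : conv b N.+1 g m' = conv b N.+1 m g.
  have S := skew_conv b xg xh; rewrite mulVf // in S.
  have S' := skew_conv b xm xp; rewrite mul1r in S'.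
  have := skew_inj S S' Z1.
  rewrite !(convZl, convZr) conv0l addr0 scale1r (conv_shiftr b N m D0).
  rewrite scalerA mulrN mulKf // scaleNr -scalerN -scalerDr => /(scalerI c0).
  by rewrite convBr addrC => /addrI /oppr_inj.
have E2 : conv b N.+1 m' g = conv b N.+1 g m.
  have S := skew_conv b xh xg; rewrite mulfV // in S.
  have S' := skew_conv b xp xm; rewrite mul1r in S'.
  have := skew_inj S S' Z2.
  rewrite conv0r !(convZl, convZr) scaler0 add0r (conv_shiftl N m b0 D0).
  rewrite !scalerA [c * b]mulrC scaleNr -scalerBr.
  move=> /(scalerI (mulf_neq0 b0 c0)).
  by rewrite convBl => /addrI /oppr_inj.
set e := m' N.+1 - m N.+1.
have T1 : conv b N.+1 m g - conv b N.+1 g m = e.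
  by rewrite -E1 (conv_topr b (n := N.+1) g m'm) g0 mul1r.
have T2 : conv b N.+1 g m - conv b N.+1 m g = b ^- N.+1 *: e.
  by rewrite -E2 (conv_topl b (n := N.+1) g m'm) g0 mulr1.
have : (1 + b ^- N.+1) *: e = 0.
  by rewrite scalerDl scale1r -T2 -T1 addrA subrK subrr.
move=> /eqP; rewrite scaler_eq0 (negPf bN) => /eqP e0; split.
  by apply/eqP; rewrite -subr_eq0 -/e e0.
by apply/eqP; rewrite -subr_eq0 T2 e0 scaler0.
Qed.

Lemma commute_top g m N :
  g 0 = 1 ->
  (forall k, (k <= N.+2)%N -> skew x b^-1 (g k) (c *: m k)) ->
  (forall k, (k < N.+2)%N -> x * m k = m k * x) ->
  conv b N.+2 g m = conv b N.+2 m g ->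
  x * m N.+2 = m N.+2 * x.
Proof.
move=> g0 xg xm E; pose r k := x * m k - m k * x.
have r0 k : (k < N.+2)%N -> r k = 0 by rewrite /r => /xm->; rewrite subrr.
have xr k : (k <= N.+2)%N -> skew x 1 (m k) (r k).
  by rewrite /skew scale1r addrC subrK.
have S := skew_conv b xg xr; have S' := skew_conv b xr xg.
rewrite mulrC in S; have := skew_inj S S' E.
rewrite convZl convZr scale1r addrC => /addrI.
have := conv_topr b g r0; have := conv_topl b g r0.
rewrite conv0l conv0r !subr0 g0 mul1r mulr1 => -> -> /eqP.
rewrite -subr_eq0 -scalerBl scaler_eq0 !subr_eq0 => /orP[|/eqP//].
by rewrite (inj_eq invr_inj) exprS -subr_eq0 -[X in X - _]mulr1 -mulrBr
  mulf_eq0 (negPf b0) subr_eq0 eq_sym (negPf (b1 N)).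
Qed.

End InductionStep.

Section AlternatingRelations.
Set Implicit Arguments.
Unset Strict Implicit.
Variables (F : fieldType) (U : algType F) (b : F).
Hypotheses (b0 : b != 0) (b1 : forall n, b ^+ n.+1 != 1).
Let c : F := 1 - b^-1.

Let c0 : c != 0.
Proof. by have := b1 0; rewrite subr_eq0 [1 == _]eq_sym invr_eq1 expr1. Qed.

Let bE : b - 1 = b * c. Proof. by rewrite mulrBr mulfV // mulr1. Qed.

Let bc0 : b * c != 0. Proof. exact: mulf_neq0. Qed.

Let bN n : 1 + b ^- n.+1 != 0.
Proof.
apply/negP; rewrite addr_eq0 => /eqP bn.
have /negP[] := b1 (n.+1 + n); rewrite -addnS exprD.
have -> : b ^+ n.+1 = -1.
  by apply: invr_inj; rewrite invrN1; apply: oppr_inj; rewrite -bn opprK.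
by rewrite mulrNN mulr1.
Qed.

Lemma qcomm_skewl (x z w : U) :
  qcomm b x z = (b * c) *: w -> skew x b^-1 z (c *: w).
Proof.
move=> /eqP; rewrite subr_eq => /eqP /(congr1 (fun t => b^-1 *: t)).
by rewrite scalerDr !scalerA mulVf // scale1r mulKf // addrC.
Qed.

Lemma qcomm_skewr (x z w : U) :
  qcomm b z x = (b * c) *: w -> skew x b z (- (b * c) *: w).
Proof.
by rewrite /skew scaleNr => <-; rewrite /qcomm opprB addrC subrK.
Qed.

Lemma qcommZr a e (x z : U) : qcomm a x (e *: z) = e *: qcomm a x z.
Proof.
by rewrite /qcomm -scalerAr -scalerAl scalerBr !scalerA mulrC.
Qed.

Lemma commZr e (x z : U) : comm x (e *: z) = e *: comm x z.
Proof. by rewrite /comm -scalerAr -scalerAl scalerBr. Qed.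

Lemma qcommC a (x z : U) :
  qcomm a x (qcomm a^-1 x z) = qcomm a^-1 x (qcomm a x z).
Proof.
rewrite /qcomm !mulrBr !mulrBl -!(scalerAl, scalerAr) !scalerBr !scalerA.
by rewrite [a * a^-1]mulrC !mulrA !opprB addrACA [- _ - _]addrC addrACA.
Qed.

Variables x y : U.
Hypotheses (serre_xy : comm x (qcomm b^-1 x (qcomm b x y)) = 0)
           (serre_yx : comm y (qcomm b^-1 y (qcomm b y x)) = 0).

Local Notation g := (altG b x y).
Local Notation h := (altGt b x y).
Local Notation m := (altWm b x y).
Let p n := altWp b x y n.+1.
(* The values of W_{-n} and W_{n+1} computed from the second G-family. *)
Let m' n := (b * c)^-1 *: qcomm b (h n) x.
Let p' n := (b * c)^-1 *: qcomm b y (h n).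

Let qcomm_xg n : qcomm b x (g n) = (b * c) *: m n.
Proof.
case: n => [|n]; last by rewrite altWmE // -bE scalerA divff ?scale1r // bE.
by rewrite /qcomm mulr1 mul1r -bE scalerBl scale1r.
Qed.

Let qcomm_gy n : qcomm b (g n) y = (b * c) *: p n.
Proof.
rewrite /p; case: n => [|n].
  by rewrite /qcomm mulr1 mul1r -bE scalerBl scale1r.
by rewrite altWpE // -bE scalerA divff ?scale1r // bE.
Qed.

Let xg n : skew x b^-1 (g n) (c *: m n).
Proof. exact: qcomm_skewl (qcomm_xg n). Qed.

Let yg n : skew y b (g n) (- (b * c) *: p n).
Proof. exact: qcomm_skewr (qcomm_gy n). Qed.

Let xh n : skew x b (h n) (- (b * c) *: m' n).
Proof. by apply: qcomm_skewr; rewrite /m' scalerA divff ?scale1r. Qed.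

Let yh n : skew y b^-1 (h n) (c *: p' n).
Proof. by apply: qcomm_skewl; rewrite /p' scalerA divff ?scale1r. Qed.

Let xp n : skew x 1 (p n) (c *: (h n.+1 - g n.+1)).
Proof.
rewrite altGtE // [_ + _ - _]addrAC subrr add0r scalerA divff // scale1r.
by rewrite /skew scale1r addrC subrK.
Qed.

Let g0 : g 0 = 1. Proof. by []. Qed.
Let h0 : h 0 = 1. Proof. by []. Qed.

Let determinant N : conv b N.+1 g h = conv b N m p.
Proof.
have -> : conv b N m p
    = \sum_(0 <= k < N.+1) b ^- k *: (m k * altWp b x y (N.+1 - k)).
  by rewrite big_mkord; apply: eq_bigr => i _; rewrite subSn // -ltnS.
rewrite /conv big_ord_recl /= big_ord_recr /= subn0 subnn h0 g0 expr0 invr1.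
rewrite scale1r mul1r mulr1 /bump add1n.
have -> : \sum_(i < N) b ^- (1 + i) *: (g (1 + i) * h (N.+1 - (1 + i))%N)
  = \sum_(1 <= k < N.+1) b ^- k *: (g k * h (N.+1 - k)%N).
  by rewrite big_add1 big_mkord.
set S := \sum_(1 <= k < _) _; set T := \sum_(0 <= k < _) _.
have : (1 + b ^- N.+1) *: g N.+1 = T - S - c^-1 *: comm x (altWp b x y N.+1).
  rewrite {1}altGE // scalerDr !scalerA mulfV ?bN // scale1r invfM mulrA.
  by rewrite mulfV ?bN // mul1r -scalerN /comm opprB.
rewrite scalerDl scale1r altGtE // => /eqP; rewrite eq_sym !subr_eq => /eqP ->.
by rewrite [S + _]addrC addrA; congr (_ + _); exact: addrAC.
Qed.

Let g1 : exists e, g 1 = e *: qcomm b^-1 x y.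
Proof.
exists (- ((1 + b^-1) * c)^-1); rewrite altGE // big_nat1 big_geq // subr0.
have -> : (1 + b ^- 1)^-1 = ((1 + b^-1) * c)^-1 * c.
  by rewrite invfM mulrVK // unitfE.
rewrite expr0 invr1 scale1r expr1 -scalerA -scalerDr scaleNr -scalerN.
rewrite /qcomm /comm scalerBl scale1r opprB; congr (_ *: _).
rewrite addrC; exact: (subrKA (x * y)).
Qed.

Let commute_x1 : x * m 1 = m 1 * x.
Proof.
have [e g1e] := g1; apply/eqP; rewrite -subr_eq0; apply/eqP.
apply: (scalerI bc0); rewrite -commZr -qcomm_xg g1e qcommZr commZr qcommC.
by rewrite serre_xy !scaler0.
Qed.

Let commute_y1 : y * p 1 = p 1 * y.
Proof.
have [e g1e] := g1; apply/eqP; rewrite -subr_eq0; apply/eqP.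
apply: (scalerI bc0); rewrite -commZr -qcomm_gy g1e.
have -> : qcomm b (e *: qcomm b^-1 x y) y
    = e *: qcomm b^-1 y (qcomm b y x).
  rewrite /qcomm -!(scalerAl, scalerAr) !mulrBr !mulrBl -!(scalerAl, scalerAr).
  rewrite !scalerBr !scalerA !mulrA [b * e]mulrC mulfK // divfK // !opprB.
  exact: addrC.
by rewrite commZr serre_yx !scaler0.
Qed.

Let D n := h n - g n.

Definition level_relations n : Prop :=
  [/\ m' n = m n /\ p' n = p n, x * m n = m n * x /\ y * p n = p n * y,
      conv b n g m = conv b n m g /\ conv b n h p = conv b n p h
    & (0 < n)%N -> skew y 1 (m n.-1) (c *: (g n - h n))].

Let level0 : level_relations 0.
Proof.
have b1c : b - 1 != 0 by rewrite bE.
split=> //; split.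
- rewrite /m' -bE /qcomm h0 mulr1 mul1r -[X in _ *: (_ - X)]scale1r.
  by rewrite -scalerBl scalerA mulVf // scale1r.
- rewrite /p' -bE /qcomm h0 mulr1 mul1r -[X in _ *: (_ - X)]scale1r.
  by rewrite -scalerBl scalerA mulVf // scale1r.
- by rewrite /conv !big_ord1 mulr1 mul1r.
- by rewrite /conv !big_ord1 mulr1 mul1r.
Qed.

Let levelS N : (forall k, (k <= N)%N -> level_relations k) ->
  level_relations N.+1.
Proof.
move=> IH.
have m'm k : (k <= N)%N -> m' k = m k by move=> /IH[[]].
have p'p k : (k <= N)%N -> p' k = p k by move=> /IH[[]].
have xm k : (k <= N)%N -> x * m k = m k * x by move=> /IH[_ []].
have yp k : (k <= N)%N -> y * p k = p k * y by move=> /IH[_ []].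
have [_ _ [EN EN'] _] := IH N (leqnn N).
have ym k : (k < N)%N -> skew y 1 (m k) (c *: (g k.+1 - h k.+1)).
  by move=> /IH[_ _ _ /(_ isT)].
have D0 : D 0 = 0 by rewrite /D g0 h0 subrr.
have Dx : conv b N.+1 h D - conv b N.+1 D h = conv b N m p - conv b N p m.
  by apply: (conv_commute b0 b1) => // k le_kN; rewrite -m'm.
pose D1 k := if k is k'.+1 then c^-1 *: comm (m k') y else 0.
have DD1 k : (k < N.+1)%N -> D1 k = D k.
  case: k => [|k] //= /ym; rewrite /skew scale1r /comm => ->.
  by rewrite opprD addrA subrr sub0r -scalerN scalerA mulVf // scale1r opprB.
have Dy : conv b N.+1 g D1 - conv b N.+1 D1 g = conv b N m p - conv b N p m.
  apply: oppr_inj; rewrite [RHS]opprB opprD.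
  rewrite -[- conv _ _ g D1]scaleN1r -[- conv _ _ D1 g]scaleN1r.
  rewrite -(convZr b _ _ g D1) -(convZl b _ _ D1 g).
  apply: (conv_commute b0 b1 (x := y)) => // [k _|]; last by rewrite scaler0.
  rewrite scaleN1r scalerN scalerA mulfV // scale1r /skew scale1r /comm opprB.
  by rewrite addrC subrK.
have {}DD1 k : (k <= N.+1)%N -> D1 k = D k.
  rewrite leq_eqVlt => /predU1P[->|]; last exact: DD1.
  have hD : conv b N.+1 h D - conv b N.+1 g D
      = conv b N.+1 D h - conv b N.+1 D g by rewrite -convBl -convBr.
  have e : conv b N.+1 g D1 - conv b N.+1 g D
      = conv b N.+1 D1 g - conv b N.+1 D g.
    have -> : conv b N.+1 g D1
        = conv b N.+1 D1 g + (conv b N.+1 h D - conv b N.+1 D h).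
      by rewrite Dx -Dy addrC subrK.
    have -> : conv b N.+1 h D
        = conv b N.+1 D h - conv b N.+1 D g + conv b N.+1 g D.
      by rewrite -hD subrK.
    by rewrite -addrA; congr (_ + _); rewrite addrAC addrK addrC addrA addNr add0r.
  move: e; rewrite (conv_topr b g DD1) (conv_topl b g DD1) g0 mul1r mulr1.
  move=> /eqP; rewrite -subr_eq0 -[X in X - _]scale1r -scalerBl scaler_eq0.
  rewrite subr_eq0 [1 == _]eq_sym invr_eq1 (negPf (b1 N)) subr_eq0.
  by move=> /eqP.
have {}ym k : (k <= N)%N -> skew y 1 (m k) (c *: (g k.+1 - h k.+1)).
  move=> le_kN; have e : h k.+1 - g k.+1 = c^-1 *: comm (m k) y.
    exact/esym/(DD1 k.+1).
  rewrite -opprB e scalerN scalerA mulfV // scale1r /skew scale1r /comm opprB.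
  by rewrite addrC subrK.
have Z1 := determinant N.
have Z2 : conv b N.+1 h g = conv b N p m.
  move: Dx; rewrite (convBr b _ h h g) (convBl b _ h g h) opprB.
  by rewrite [X in X = _]addrC subrKA Z1 => /addrI /oppr_inj.
have [m'n E] : m' N.+1 = m N.+1 /\ conv b N.+1 g m = conv b N.+1 m g.
  apply: (fused_determinants b0 b1 _ _ (x := x) (h := h) (p := p)) => //.
    by move=> k /xm /skew1P.
have [p'n E'] : p N.+1 = p' N.+1 /\ conv b N.+1 h p' = conv b N.+1 p' h.
  apply: (fused_determinants b0 b1 _ _ (x := y) (h := g) (p := m)) => //.
  - by move=> k /p'p.
  - by move=> k le_kN; rewrite p'p //; apply/skew1P/yp.
  - by rewrite Z2; apply: eq_conv => // k /p'p.
  - by rewrite Z1; apply: eq_conv => // k /p'p.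
have {}p'p k : (k <= N.+1)%N -> p' k = p k.
  by rewrite leq_eqVlt => /predU1P[->|/p'p].
have {}E' : conv b N.+1 h p = conv b N.+1 p h.
  have -> : conv b N.+1 h p = conv b N.+1 h p' by apply: eq_conv => // k /p'p.
  by rewrite E'; apply: eq_conv => // k /p'p.
split=> //=; last by move=> _; exact: ym.
case: N xm yp E E' p'p {IH EN EN' ym D0 Dx D1 DD1 Dy Z1 Z2 m'm m'n p'n}.
  by split.
move=> N xm yp E E' p'p; split.
  exact: (commute_top b0 b1 (g := g)).
by apply: (commute_top b0 b1 (g := h)) => // k ?; rewrite -p'p.
Qed.

Lemma level_relationsP n : level_relations n.
Proof.
elim/ltn_ind: n => -[_|n IH]; first exact: level0.
by apply: levelS => k le_kn; apply: IH.
Qed.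

Lemma comm_W0_G n : comm x (qcomm b x (g n)) = 0.
Proof.
have [_ [xm _] _ _] := level_relationsP n.
by rewrite qcomm_xg commZr /comm xm subrr scaler0.
Qed.

Lemma comm_W0_Gt n : comm x (qcomm b (h n) x) = 0.
Proof.
have [[m'm _] [xm _] _ _] := level_relationsP n.
have -> : qcomm b (h n) x = (b * c) *: m n.
  by rewrite -m'm scalerA mulfV // scale1r.
by rewrite commZr /comm xm subrr scaler0.
Qed.

Lemma comm_W1_G n : comm y (qcomm b (g n) y) = 0.
Proof.
have [_ [_ yp] _ _] := level_relationsP n.
by rewrite qcomm_gy commZr /comm yp subrr scaler0.
Qed.

Lemma comm_W1_Gt n : comm y (qcomm b y (h n)) = 0.
Proof.
have [[_ p'p] [_ yp] _ _] := level_relationsP n.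
have -> : qcomm b y (h n) = (b * c) *: p n.
  by rewrite -p'p scalerA mulfV // scale1r.
by rewrite commZr /comm yp subrr scaler0.
Qed.

End AlternatingRelations.

Section EigenFamilies.
Set Implicit Arguments.
Unset Strict Implicit.
Variables (F : fieldType) (V : vectType F) (d : nat).
Implicit Types (A B G : 'End(V)) (E Es : 'I_d.+1 -> 'End(V)).
Implicit Types (W : {vspace V}) (i j : 'I_d.+1) (ev : 'I_d.+1 -> F).

Record eigen_family A E ev : Prop := EigenFamily {
  ef_eigen : forall i v, v \in limg (E i) -> A v = ev i *: v;
  ef_id : forall i v, v \in limg (E i) -> E i v = v;
  ef_orth : forall i j v, j != i -> v \in limg (E j) -> E i v = 0;
  ef_full : (\sum_i limg (E i))%VS = fullv;
  ef_neq0 : forall i, limg (E i) != 0%VS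
}.

Lemma eigen_family_rev A E ev : eigen_family A E ev ->
  eigen_family A (E \o @rev_ord d.+1) (ev \o @rev_ord d.+1).
Proof.
case=> eigen idem orth full neq0; split=> //= [i v|i v|i j v ji|].
- exact: eigen.
- exact: idem.
- by apply: orth; rewrite (inj_eq rev_ord_inj).
- by rewrite -[RHS]full [RHS](reindex_inj rev_ord_inj).
Qed.

Lemma eigen_family_sum A E ev v : eigen_family A E ev ->
  v = \sum_i E i v.
Proof.
move=> [_ idem orth full _].
have /memv_sumP[w wE ->] : v \in (\sum_i limg (E i))%VS by rewrite full memvf.
apply: eq_bigr => i _; rewrite linear_sum (bigD1 i) //= idem ?wE //.
by rewrite big1 ?addr0 // => j ji; rewrite (orth i j) ?wE.
Qed.

Lemma eigen_family_proj A E ev i v : eigen_family A E ev ->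
  E i (A v) = ev i *: E i v.
Proof.
move=> ef; have [eigen idem orth _ _] := ef.
have mem j : E j v \in limg (E j) by rewrite memv_img ?memvf.
rewrite {1}(eigen_family_sum v ef) !linear_sum /= (bigD1 i) //=.
rewrite (eigen _ _ (mem i)) linearZ /= (idem _ _ (mem i)) big1 ?addr0 // => j ji.
by rewrite (eigen _ _ (mem j)) linearZ /= (orth _ _ _ ji (mem j)) scaler0.
Qed.

Lemma eigen_family_mem A E ev W v : eigen_family A E ev ->
  (forall i, E i v != 0 -> (limg (E i) <= W)%VS) -> v \in W.
Proof.
move=> ef EW; rewrite (eigen_family_sum v ef); apply: rpred_sum => i _.
have [->|/EW/subvP] := eqVneq (E i v) 0; first exact: rpred0.
by apply; rewrite memv_img ?memvf.
Qed.

Lemma sub_sp_pred (S : 'I_d.+1 -> {vspace V}) i j :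
  j.+1 = i -> (S j <= sp_pred S i)%VS.
Proof. by move=> ji; apply: sumv_sup (subvv _); rewrite ji. Qed.

Lemma sub_sp_succ (S : 'I_d.+1 -> {vspace V}) i j :
  j = i.+1 :> nat -> (S j <= sp_succ S i)%VS.
Proof. by move=> ji; apply: sumv_sup (subvv _); rewrite ji. Qed.

Section Geometric.
Variables (A : 'End(V)) (E : 'I_d.+1 -> 'End(V)) (ev : 'I_d.+1 -> F).
Variable beta : F.
Hypotheses (ef : eigen_family A E ev) (ev_inj : injective ev) (d_gt0 : (0 < d)%N).
Hypothesis evS : forall i j, j = i.+1 :> nat -> ev j = beta * ev i.
Hypotheses (beta0 : beta != 0) (beta1 : forall n, beta ^+ n.+1 != 1).

Lemma geometric_exp i : ev i = beta ^+ i * ev ord0.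
Proof.
case: i => n; elim: n => [|n IHn] lt_nd.
  by rewrite mul1r; congr ev; apply: val_inj.
rewrite (@evS (Ordinal (ltnW lt_nd))) //.
by rewrite IHn mulrA -exprS.
Qed.

Lemma geometric_neq0 : ev ord0 != 0.
Proof.
apply/negP => /eqP ev0; have lt1d : (1 < d.+1)%N by [].
have := @evS ord0 (Ordinal lt1d) erefl; rewrite ev0 mulr0 -ev0 => /ev_inj.
by move=> /(congr1 val).
Qed.

Lemma geometric_step i j : beta * ev i = ev j -> j = i.+1 :> nat.
Proof.
rewrite (geometric_exp i) (geometric_exp j) mulrA -exprS.
move=> /(mulIf geometric_neq0) e.
have expI m n : (m <= n)%N -> beta ^+ m = beta ^+ n -> m = n.
  move=> le_mn; rewrite -(subnKC le_mn) exprD -[X in X = _]mulr1.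
  move=> /(mulfI (expf_neq0 _ beta0)); case: (n - m)%N => [|k]; rewrite ?addn0 //.
  by move=> /eqP; rewrite eq_sym (negPf (beta1 k)).
by case/orP: (leq_total i.+1 j) => /expI le; [rewrite le | rewrite -le].
Qed.

Lemma acts_lower_geometric G :
  (forall i j v, v \in limg (E j) -> E i (G v) != 0 ->
    ev i = ev j \/ beta * ev i = ev j) ->
  acts_lower G (fun i => limg (E i)).
Proof.
move=> EG j; apply/subvP => _ /memv_imgP[v vE ->].
apply: (eigen_family_mem ef) => i /(EG i j v vE)[/ev_inj->|/geometric_step ji].
  exact: addvSr.
apply: subv_trans (addvSl _ _).
exact: (sub_sp_pred (fun i => limg (E i))).
Qed.

Lemma acts_raise_geometric G :
  (forall i j v, v \in limg (E j) -> E i (G v) != 0 ->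
    ev i = ev j \/ ev i = beta * ev j) ->
  acts_raise G (fun i => limg (E i)).
Proof.
move=> EG j; apply/subvP => _ /memv_imgP[v vE ->].
apply: (eigen_family_mem ef) => i /(EG i j v vE)[/ev_inj->|/esym/geometric_step ij].
  exact: addvSl.
apply: subv_trans (addvSr _ _).
exact: (sub_sp_succ (fun i => limg (E i))).
Qed.

End Geometric.

Lemma eigen_left_qcomm A E ev b G : eigen_family A E ev ->
  (forall v, A (b *: A (G v) - G (A v)) = b *: A (G (A v)) - G (A (A v))) ->
  forall i j v, v \in limg (E j) -> E i (G v) != 0 ->
    ev i = ev j \/ b * ev i = ev j.
Proof.
move=> ef rel i j v vE Ev; have Av := ef_eigen ef vE.
have GA : G (A v) = ev j *: G v by rewrite Av linearZ.
have GAA : G (A (A v)) = ev j *: (ev j *: G v).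
  by rewrite Av !linearZ /= GA.
have := congr1 (E i) (rel v); rewrite GAA GA !(linearB, linearZ) /=.
rewrite !(eigen_family_proj _ _ ef) !scalerN !scalerA -!scalerBl.
move=> /eqP; rewrite -subr_eq0 -scalerBl scaler_eq0 (negPf Ev) orbF.
have -> : b * (ev i * ev i) - ev j * ev i - (b * ev j * ev i - ev j * ev j)
  = (ev i - ev j) * (b * ev i - ev j) by ring.
by rewrite mulf_eq0 !subr_eq0 => /orP[] /eqP; [left | right].
Qed.

Lemma eigen_right_qcomm A E ev b G : eigen_family A E ev ->
  (forall v, A (b *: G (A v) - A (G v)) = b *: G (A (A v)) - A (G (A v))) ->
  forall i j v, v \in limg (E j) -> E i (G v) != 0 ->
    ev i = ev j \/ ev i = b * ev j.
Proof.
move=> ef rel i j v vE Ev; have Av := ef_eigen ef vE.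
have GA : G (A v) = ev j *: G v by rewrite Av linearZ.
have GAA : G (A (A v)) = ev j *: (ev j *: G v).
  by rewrite Av !linearZ /= GA.
have := congr1 (E i) (rel v); rewrite GAA GA !(linearB, linearZ) /=.
rewrite !(eigen_family_proj _ _ ef) !scalerN !scalerA -!scalerBl.
move=> /eqP; rewrite -subr_eq0 -scalerBl scaler_eq0 (negPf Ev) orbF.
have -> : b * ev j * ev i - ev i * ev i - (b * ev j * ev j - ev j * ev i)
  = (ev j - ev i) * (ev i - b * ev j) by ring.
by rewrite mulf_eq0 !subr_eq0 => /orP[] /eqP; [left | right].
Qed.

Section Flags.
Variable E : 'I_d.+1 -> 'End(V).
Local Notation X := (fun i => limg (E i)).

Definition sum_lt (k : nat) : {vspace V} :=
  (\sum_(j < d.+1 | (j < k)%N) limg (E j))%VS.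

Lemma sub_sum_ge k l : (l <= k)%N -> (sum_ge E k <= sum_ge E l)%VS.
Proof.
move=> le_lk; apply/subv_sumP => j le_kj.
exact: sumv_sup (leq_trans le_lk le_kj) (subvv _).
Qed.

Lemma sub_sum_lt k l : (k <= l)%N -> (sum_lt k <= sum_lt l)%VS.
Proof.
move=> le_kl; apply/subv_sumP => j lt_jk.
exact: sumv_sup (leq_trans lt_jk le_kl) (subvv _).
Qed.

Lemma sum_lt0 : sum_lt 0 = 0%VS. Proof. exact: big_pred0. Qed.

Lemma sum_ge_top k : (d < k)%N -> sum_ge E k = 0%VS.
Proof.
move=> lt_dk; apply: big_pred0 => j; apply/negbTE; rewrite -ltnNge.
exact: leq_ltn_trans (leq_ord j) lt_dk.
Qed.

Lemma limg_sum_ge G k W :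
  (forall i, (k <= i)%N -> (G @: limg (E i) <= W)%VS) -> (G @: sum_ge E k <= W)%VS.
Proof. by move=> GW; rewrite limg_sum; apply/subv_sumP. Qed.

Lemma limg_sum_lt G k W :
  (forall i, (i < k)%N -> (G @: limg (E i) <= W)%VS) -> (G @: sum_lt k <= W)%VS.
Proof. by move=> GW; rewrite limg_sum; apply/subv_sumP. Qed.

Lemma sub_ge k i : (k <= i)%N -> (limg (E i) <= sum_ge E k)%VS.
Proof. by move=> le_ki; apply: sumv_sup (subvv _). Qed.

Lemma sub_lt k i : (i < k)%N -> (limg (E i) <= sum_lt k)%VS.
Proof. by move=> lt_ik; apply: sumv_sup (subvv _). Qed.

Lemma sp_pred_ge k i : (k <= i)%N -> (sp_pred X i <= sum_ge E k.-1)%VS.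
Proof.
move=> le_ki; apply/subv_sumP => j /eqP ji; apply: sub_ge.
by rewrite -ltnS -ji in le_ki *; case: k le_ki.
Qed.

Lemma sp_pred_lt k i : (i < k)%N -> (sp_pred X i <= sum_lt k)%VS.
Proof.
move=> lt_ik; apply/subv_sumP => j /eqP ji; apply: sub_lt.
by apply: leq_trans lt_ik; rewrite ltnS -ji leqnSn.
Qed.

Lemma sp_succ_ge k i : (k <= i)%N -> (sp_succ X i <= sum_ge E k.+1)%VS.
Proof.
by move=> le_ki; apply/subv_sumP => j /eqP ji; apply: sub_ge; rewrite ji ltnS.
Qed.

Lemma sp_succ_lt k i : (i < k)%N -> (sp_succ X i <= sum_lt k.+1)%VS.
Proof.
by move=> lt_ik; apply/subv_sumP => j /eqP ji; apply: sub_lt; rewrite ji ltnS.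
Qed.

Lemma lower_ge G k : acts_lower G X -> (G @: sum_ge E k <= sum_ge E k.-1)%VS.
Proof.
move=> GX; apply: limg_sum_ge => i le_ki; apply: subv_trans (GX i) _.
rewrite subv_add sp_pred_ge //=.
by apply: sub_ge; apply: leq_trans le_ki; exact: leq_pred.
Qed.

Lemma lower_lt G k : acts_lower G X -> (G @: sum_lt k <= sum_lt k)%VS.
Proof.
move=> GX; apply: limg_sum_lt => i lt_ik; apply: subv_trans (GX i) _.
by rewrite subv_add sp_pred_lt ?sub_lt.
Qed.

Lemma raise_ge G k : acts_raise G X -> (G @: sum_ge E k <= sum_ge E k)%VS.
Proof.
move=> GX; apply: limg_sum_ge => i le_ki; apply: subv_trans (GX i) _.
rewrite subv_add sub_ge //=.
exact: subv_trans (sp_succ_ge le_ki) (sub_sum_ge (leqnSn k)).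
Qed.

Lemma raise_lt G k : acts_raise G X -> (G @: sum_lt k <= sum_lt k.+1)%VS.
Proof.
move=> GX; apply: limg_sum_lt => i lt_ik; apply: subv_trans (GX i) _.
by rewrite subv_add sp_succ_lt // sub_lt // leqW.
Qed.

Lemma tridiag_ge G k : acts_tridiag G X -> (G @: sum_ge E k <= sum_ge E k.-1)%VS.
Proof.
move=> GX; apply: limg_sum_ge => i le_ki; apply: subv_trans (GX i) _.
rewrite !subv_add sp_pred_ge //=; apply/andP; split.
  by apply: sub_ge; apply: leq_trans le_ki; exact: leq_pred.
apply: subv_trans (sp_succ_ge le_ki) (sub_sum_ge _).
exact: leq_trans (leq_pred k) (leqnSn k).
Qed.

Lemma tridiag_lt G k : acts_tridiag G X -> (G @: sum_lt k <= sum_lt k.+1)%VS.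
Proof.
move=> GX; apply: limg_sum_lt => i lt_ik; apply: subv_trans (GX i) _.
rewrite !subv_add sp_succ_lt // (sub_lt (leqW lt_ik)) !andbT.
exact: subv_trans (sp_pred_lt lt_ik) (sub_sum_lt (leqnSn k)).
Qed.

Lemma eigen_ge A ev v i : eigen_family A E ev ->
  v \in sum_ge E i -> A v - ev i *: v \in sum_ge E i.+1.
Proof.
move=> ef /memv_sumP[w wE ->]; rewrite linear_sum scaler_sumr -sumrB /=.
apply: rpred_sum => j le_ij; rewrite (ef_eigen ef (wE j le_ij)) -scalerBl.
have [->|ji] := eqVneq j i; first by rewrite subrr scale0r rpred0.
apply/rpredZ/(subvP (sub_ge _))/wE => //.
by rewrite ltn_neqAle eq_sym ji.
Qed.

Lemma eigen_lt A ev v i : eigen_family A E ev ->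
  v \in sum_lt i.+1 -> A v - ev i *: v \in sum_lt i.
Proof.
move=> ef /memv_sumP[w wE ->]; rewrite linear_sum scaler_sumr -sumrB /=.
apply: rpred_sum => j le_ji; rewrite (ef_eigen ef (wE j le_ji)) -scalerBl.
have [->|ji] := eqVneq j i; first by rewrite subrr scale0r rpred0.
apply/rpredZ/(subvP (sub_lt _))/wE => //.
by rewrite ltn_neqAle ji -ltnS.
Qed.

End Flags.

Section SplitDecomposition.
Variables (A B : 'End(V)) (E Es : 'I_d.+1 -> 'End(V)).
Variables (ev evs : 'I_d.+1 -> F).
Hypotheses (efA : eigen_family A E ev) (efB : eigen_family B Es evs).
Hypotheses (triA : acts_tridiag A (fun i => limg (Es i)))
           (triB : acts_tridiag B (fun i => limg (E i))).
Hypothesis irr : forall W, (A @: W <= W)%VS -> (B @: W <= W)%VS ->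
  W = 0%VS \/ W = fullv.

Local Notation L := (sum_lt Es).
Local Notation R := (sum_ge E).

(* Stable under A and B for every r, hence 0 or V; it is 0 for r = 1 because it
   misses the last eigenspace of B, and V for r = 0. *)
Definition shifted_cap r : {vspace V} :=
  (\sum_(k < d.+1) (L k.+1 :&: R (k + r)))%VS.

Lemma sub_shifted_cap r k : (L k.+1 :&: R (k + r) <= shifted_cap r)%VS.
Proof.
have [lt_kd|lt_dk] := ltnP k d.+1; first exact: (sumv_sup (Ordinal lt_kd)).
by rewrite sum_ge_top ?capv0 ?sub0v // (leq_trans lt_dk) ?leq_addr.
Qed.

Lemma shifted_cap_stablel r : (A @: shifted_cap r <= shifted_cap r)%VS.
Proof.
rewrite limg_sum; apply/subv_sumP => k _.
apply/subvP => _ /memv_imgP[v vC ->]; have := vC; rewrite memv_cap => /andP[vL vR].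
have [lt_kd|lt_dk] := ltnP (k + r) d.+1; last first.
  by move: vR; rewrite sum_ge_top // memv0 => /eqP->; rewrite linear0 rpred0.
rewrite -(subrK (ev (Ordinal lt_kd) *: v) (A v)); apply: rpredD; last first.
  by apply: rpredZ; apply: (subvP (sub_shifted_cap r k)).
apply: (subvP (sub_shifted_cap r k.+1)); rewrite memv_cap addSn.
rewrite (eigen_ge (i := Ordinal lt_kd) efA vR) andbT rpredB //.
  by apply: (subvP (tridiag_lt _ triA)); rewrite memv_img.
by apply/rpredZ/(subvP (sub_sum_lt _ (leqnSn _))).
Qed.

Lemma shifted_cap_stabler r : (B @: shifted_cap r <= shifted_cap r)%VS.
Proof.
rewrite limg_sum; apply/subv_sumP => k _.
apply/subvP => _ /memv_imgP[v vC ->]; have := vC; rewrite memv_cap => /andP[vL vR].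
rewrite -(subrK (evs k *: v) (B v)); apply: rpredD; last first.
  by apply: rpredZ; apply: (subvP (sub_shifted_cap r k)).
have wL := eigen_lt efB vL.
have wR : B v - evs k *: v \in R (k + r).-1.
  apply: rpredB; first by apply: (subvP (tridiag_ge _ triB)); rewrite memv_img.
  by apply/rpredZ/(subvP (sub_sum_ge _ (leq_pred _))).
case: (nat_of_ord k) wL wR => [|k'] wL wR.
  by move: wL; rewrite sum_lt0 memv0 => /eqP->; rewrite rpred0.
by apply: (subvP (sub_shifted_cap r k')); rewrite memv_cap wL.
Qed.

Lemma shifted_cap1 : shifted_cap 1 = 0%VS.
Proof.
have [//|full] := irr (shifted_cap_stablel 1) (shifted_cap_stabler 1).
have subL : (shifted_cap 1 <= L d)%VS.
  apply/subv_sumP => k _; have [lt_kd|le_dk] := ltnP k d.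
    exact: subv_trans (capvSl _ _) (sub_sum_lt _ lt_kd).
  by rewrite sum_ge_top ?capv0 ?sub0v // addn1 ltnS.
case/eqP: (ef_neq0 efB ord_max); apply/eqP; rewrite -subv0; apply/subvP => v vE.
have : v \in L d by apply: (subvP subL); rewrite full memvf.
move=> /memv_sumP[w wE vw]; rewrite -(ef_id efB vE) vw linear_sum big1 ?mem0v //=.
move=> j lt_jd; apply: (ef_orth efB) (wE j lt_jd).
by apply: contraL lt_jd => /eqP->; rewrite ltnn.
Qed.

Lemma shifted_cap0 : shifted_cap 0 = fullv.
Proof.
have [zero|//] := irr (shifted_cap_stablel 0) (shifted_cap_stabler 0).
case/eqP: (ef_neq0 efB ord0); apply/eqP; rewrite -subv0 -zero.
apply: subv_trans (sub_shifted_cap 0 0); rewrite subv_cap sub_lt //=.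
by rewrite /sum_ge (eq_bigl xpredT) ?(ef_full efA) ?subvf.
Qed.

Lemma flags_cap0 k : (L k :&: R k)%VS = 0%VS.
Proof.
case: k => [|k]; first by rewrite sum_lt0 cap0v.
apply/eqP; rewrite -subv0 -shifted_cap1.
by have := sub_shifted_cap 1 k; rewrite addn1.
Qed.

Lemma split_window k l v : (l <= k)%N -> v \in L k -> v \in R l ->
  v \in (\sum_(i < d.+1 | (l <= i < k)%N) dec_0s_D E Es i)%VS.
Proof.
move=> le_lk vL vR.
have /memv_sumP[w wE vw] : v \in shifted_cap 0 by rewrite shifted_cap0 memvf.
have wL i : w i \in L i.+1 by have := wE i isT; rewrite memv_cap => /andP[].
have wR i : w i \in R i.
  by have := wE i isT; rewrite memv_cap addn0 => /andP[].
have high : \sum_(i < d.+1 | (k <= i)%N) w i = 0.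
  apply/eqP; rewrite -memv0 -(flags_cap0 k) memv_cap; apply/andP; split.
    have -> : \sum_(i < d.+1 | (k <= i)%N) w i
        = v - \sum_(i < d.+1 | ~~ (k <= i)%N) w i.
      by rewrite vw [X in X - _](bigID (fun i : 'I_d.+1 => (k <= i)%N)) /= addrK.
    apply: rpredB => //; apply: rpred_sum => i; rewrite -ltnNge => lt_ik.
    exact: subvP (sub_sum_lt _ lt_ik) _ (wL i).
  by apply: rpred_sum => i le_ki; apply: subvP (sub_sum_ge _ le_ki) _ (wR i).
have low : \sum_(i < d.+1 | (i < l)%N) w i = 0.
  apply/eqP; rewrite -memv0 -(flags_cap0 l) memv_cap; apply/andP; split.
    by apply: rpred_sum => i lt_il; apply: subvP (sub_sum_lt _ lt_il) _ (wL i).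
  have -> : \sum_(i < d.+1 | (i < l)%N) w i = v - \sum_(i < d.+1 | ~~ (i < l)%N) w i.
    by rewrite vw [X in X - _](bigID (fun i : 'I_d.+1 => (i < l)%N)) /= addrK.
  apply: rpredB => //; apply: rpred_sum => i; rewrite -leqNgt => le_li.
  exact: subvP (sub_sum_ge _ le_li) _ (wR i).
rewrite vw (bigID (fun i : 'I_d.+1 => (k <= i)%N)) /= high add0r.
rewrite (bigID (fun i : 'I_d.+1 => (i < l)%N)) /=.
rewrite [X in X + _](_ : _ = 0) ?add0r.
  apply: rpred_sum => i; rewrite -ltnNge -leqNgt => /andP[lt_ik le_li].
  apply: (subvP (sumv_sup i _ (subvv _))); first by rewrite le_li.
  by rewrite memv_cap; apply/andP; split; [exact: wL | exact: wR].
rewrite -[RHS]low; apply: eq_bigl => i; rewrite -ltnNge.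
by case: (ltnP i l) => [lt_il|_]; rewrite ?andbF // (leq_trans lt_il).
Qed.

Section Actions.
Variables (G : 'End(V)).
Local Notation S := (dec_0s_D E Es).

Lemma split_diag : acts_lower G (fun i => limg (Es i)) ->
  acts_raise G (fun i => limg (E i)) -> acts_diag G S.
Proof.
move=> GL GR i; apply/subvP => _ /memv_imgP[v + ->].
rewrite memv_cap => /andP[vL vR].
rewrite memv_cap; apply/andP; split.
  by apply: (subvP (lower_lt i.+1 GL)); rewrite memv_img.
by apply: (subvP (raise_ge i GR)); rewrite memv_img.
Qed.

Lemma split_lower : acts_lower G (fun i => limg (Es i)) ->
  acts_lower G (fun i => limg (E i)) -> acts_lower G S.
Proof.
move=> GL GR i; apply/subvP => _ /memv_imgP[v + ->].
rewrite memv_cap => /andP[vL vR].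
have wL := subvP (lower_lt i.+1 GL) _ (memv_img G vL).
have wR := subvP (lower_ge i GR) _ (memv_img G vR).
have le_win : (i.-1 <= i.+1)%N by rewrite (leq_trans (leq_pred i)).
apply: subvP (split_window le_win wL wR); apply/subv_sumP => j /andP[le_ij].
rewrite ltnS leq_eqVlt => /predU1P[/val_inj->|lt_ji]; first exact: addvSr.
apply: subv_trans (addvSl _ _); apply: sub_sp_pred.
by apply/eqP; rewrite eqn_leq lt_ji /=; case: (nat_of_ord i) le_ij.
Qed.

Lemma split_raise : acts_raise G (fun i => limg (Es i)) ->
  acts_raise G (fun i => limg (E i)) -> acts_raise G S.
Proof.
move=> GL GR i; apply/subvP => _ /memv_imgP[v + ->].
rewrite memv_cap => /andP[vL vR].
have wL := subvP (raise_lt i.+1 GL) _ (memv_img G vL).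
have wR := subvP (raise_ge i GR) _ (memv_img G vR).
have le_win : (i <= i.+2)%N by rewrite leqW.
apply: subvP (split_window le_win wL wR); apply/subv_sumP => j /andP[].
rewrite leq_eqVlt ltnS => /predU1P[/val_inj->|lt_ij le_ji]; first by rewrite addvSl.
apply: subv_trans (addvSr _ _); apply: sub_sp_succ.
by apply/eqP; rewrite eqn_leq le_ji.
Qed.

Lemma split_tridiag : acts_raise G (fun i => limg (Es i)) ->
  acts_lower G (fun i => limg (E i)) -> acts_tridiag G S.
Proof.
move=> GL GR i; apply/subvP => _ /memv_imgP[v + ->].
rewrite memv_cap => /andP[vL vR].
have wL := subvP (raise_lt i.+1 GL) _ (memv_img G vL).
have wR := subvP (lower_ge i GR) _ (memv_img G vR).
have le_win : (i.-1 <= i.+2)%N by rewrite (leq_trans (leq_pred i)) ?leqW.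
apply: subvP (split_window le_win wL wR); apply/subv_sumP => j /andP[le_ij le_ji].
have [lt_ji|lt_ij|/val_inj->] := ltngtP j i.
- apply: subv_trans (addvSl _ _); apply: subv_trans (addvSl _ _).
  apply: sub_sp_pred.
  by apply/eqP; rewrite eqn_leq lt_ji /=; case: (nat_of_ord i) le_ij.
- apply: subv_trans (addvSr _ _); apply: sub_sp_succ.
  by apply/eqP; rewrite eqn_leq lt_ij -ltnS le_ji.
- by apply: subv_trans (addvSl _ _); exact: addvSr.
Qed.

End Actions.

End SplitDecomposition.

End EigenFamilies.

Section UqPlusRelations.
Local Open Scope quotient_scope.
Set Implicit Arguments.
Unset Strict Implicit.
Variables (F : fieldType) (b : F).
Implicit Types z w : free_alg F.

Lemma pi_UqpP z w : z - w \in serre_ideal b -> \pi_(Uqp b) z = \pi_(Uqp b) w.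
Proof. by move=> zw; apply/eqquotP; rewrite Quotient.equivE. Qed.

Lemma pi_UqpB z w : \pi_(Uqp b) (z - w) = \pi_(Uqp b) z - \pi_(Uqp b) w.
Proof. by rewrite !piE. Qed.

Lemma pi_Uqp_repr z : repr (\pi_(Uqp b) z) - z \in serre_ideal b.
Proof.
have /eqquotP : \pi_(Uqp b) (repr (\pi_(Uqp b) z)) = \pi_(Uqp b) z by rewrite reprK.
by rewrite Quotient.equivE.
Qed.

Lemma pi_UqpM z w : \pi_(Uqp b) (z * w) = \pi_(Uqp b) z * \pi_(Uqp b) w.
Proof.
apply/esym/pi_UqpP; set z' := repr _; set w' := repr _.
rewrite -(subrKA (z' * w)) -mulrBr -mulrBl rpredD //.
  by apply: serre_idealMl; apply: pi_Uqp_repr.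
by apply: serre_idealMr; apply: pi_Uqp_repr.
Qed.

Lemma pi_UqpZ a z : \pi_(Uqp b) (a *: z) = a *: \pi_(Uqp b) z.
Proof.
apply/esym/pi_UqpP; rewrite -scalerBr -[_ - _]mul1r scalerAl.
by apply: serre_idealMl; apply: pi_Uqp_repr.
Qed.

Lemma comm_qcomm_morph (R U : lalgType F) (f : R -> U) (x y : R) :
  {morph f : s t / s - t} -> {morph f : s t / s * t} ->
  (forall a, {morph f : s / a *: s}) ->
  f (comm x (qcomm b^-1 x (qcomm b x y)))
  = comm (f x) (qcomm b^-1 (f x) (qcomm b (f x) (f y))).
Proof. by move=> fB fM fZ; rewrite /comm /qcomm !(fB, fM, fZ). Qed.

Lemma Uqp_serre i :
  let x : Uqp b := \pi_(Uqp b) (free_gen F i) in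
  let y : Uqp b := \pi_(Uqp b) (free_gen F (~~ i)) in
  comm x (qcomm b^-1 x (qcomm b x y)) = 0.
Proof.
move=> x y; have <- : \pi_(Uqp b) (0 : free_alg F) = 0 by rewrite piE.
rewrite -(comm_qcomm_morph _ _ pi_UqpB pi_UqpM pi_UqpZ).
apply: pi_UqpP; rewrite subr0; apply/asboolP; exists [:: (1, i, 1)].
by rewrite big_seq1 mul1r mulr1.
Qed.

End UqPlusRelations.

Section Reversal.
Set Implicit Arguments.
Unset Strict Implicit.
Variables (F : fieldType) (V : vectType F) (d : nat).
Implicit Types (E Es : 'I_d.+1 -> 'End(V)) (S : 'I_d.+1 -> {vspace V}).
Local Notation rev := (@rev_ord d.+1).

Lemma sp_succ_rev S i : sp_succ (S \o rev) i = sp_pred S (rev i).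
Proof.
rewrite /sp_succ /sp_pred [RHS](reindex_inj rev_ord_inj); apply: eq_bigl => j.
rewrite /= !subSS; have := leq_ord i; have := leq_ord j; lia.
Qed.

Lemma sp_pred_rev S i : sp_pred (S \o rev) i = sp_succ S (rev i).
Proof.
rewrite /sp_succ /sp_pred [RHS](reindex_inj rev_ord_inj); apply: eq_bigl => j.
rewrite /= !subSS; have := leq_ord i; have := leq_ord j; lia.
Qed.

Lemma acts_lower_rev G S : acts_lower G S -> acts_raise G (S \o rev).
Proof. by move=> GS i; rewrite sp_succ_rev addvC; apply: GS. Qed.

Lemma acts_raise_rev G S : acts_raise G S -> acts_lower G (S \o rev).
Proof. by move=> GS i; rewrite sp_pred_rev addvC; apply: GS. Qed.

Lemma acts_tridiag_rev G S : acts_tridiag G S -> acts_tridiag G (S \o rev).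
Proof.
move=> GS i; rewrite sp_pred_rev sp_succ_rev; have := GS (rev i).
by rewrite addvC [(sp_pred _ _ + _)%VS]addvC addvA.
Qed.

Lemma sum_ge_rev E (i : 'I_d.+1) : sum_ge (E \o rev) i = sum_le E (d - i).
Proof.
rewrite /sum_ge /sum_le [RHS](reindex_inj rev_ord_inj); apply: eq_bigl => j.
rewrite /= subSS; have := leq_ord i; have := leq_ord j; lia.
Qed.

Lemma sum_le_rev E (i : 'I_d.+1) : sum_le (E \o rev) i = sum_ge E (d - i).
Proof.
rewrite /sum_ge /sum_le [RHS](reindex_inj rev_ord_inj); apply: eq_bigl => j.
rewrite /= subSS; have := leq_ord i; have := leq_ord j; lia.
Qed.

Lemma dec_0s_0E E Es : dec_0s_0 E Es = dec_0s_D (E \o rev) Es.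
Proof. by apply/funext => i; rewrite /dec_0s_D sum_ge_rev. Qed.

Lemma dec_Ds_DE E Es : dec_Ds_D E Es = dec_0s_D E (Es \o rev).
Proof. by apply/funext => i; rewrite /dec_0s_D sum_le_rev. Qed.

Lemma dec_Ds_0E E Es : dec_Ds_0 E Es = dec_0s_D (E \o rev) (Es \o rev).
Proof. by apply/funext => i; rewrite /dec_0s_D sum_le_rev sum_ge_rev. Qed.

Lemma eigen_family_standard A B E (S : 'I_d.+1 -> {vspace V}) theta :
  lfun_diagonalizable A -> standard_ordering A B S -> primitive_idempotents S E ->
  (forall i, eigenvalue_for A (E i) (theta i)) ->
  [/\ eigen_family A E theta, injective theta
    & acts_tridiag B (fun i => limg (E i))].
Proof.
move=> [s sfull] [[Sinj _ Sall] tri] idem evE.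
have Sfull : (\sum_i S i)%VS = fullv.
  apply/eqP; rewrite eqEsubv subvf -sfull big_tnth; apply/subv_sumP => k _.
  set a := tnth _ k; have [->|/Sall[i <-]] := eqVneq (passmx.leigenspace A a) 0%VS.
    exact: sub0v.
  exact: sumv_sup (subvv _).
have ES i : limg (E i) = S i.
  apply/eqP; rewrite eqEsubv; apply/andP; split.
    apply/subvP => _ /memv_imgP[v _ ->].
    have /memv_sumP[w wS ->] : v \in (\sum_i S i)%VS by rewrite Sfull memvf.
    rewrite linear_sum; apply: rpred_sum => j _ /=.
    have [Sid S0] := idem i (w j); have [eij|nij] := eqVneq j i.
      by rewrite -eij in Sid *; rewrite Sid wS.
    by rewrite (S0 j) ?rpred0 ?wS.
  apply/subvP => v vS; have [Sid _] := idem i v.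
  by rewrite -(Sid vS) memv_img ?memvf.
have eS : (fun i => limg (E i)) = S by apply/funext.
split; last by rewrite eS.
- split=> [i v|i v|i j v ji||i].
  + by have [_ ->] := evE i; rewrite memv_ker !lfun_simp subr_eq0 => /eqP.
  + by rewrite ES; have [] := idem i v.
  + by rewrite ES => vS; have [_ S0] := idem i v; exact: S0 ji vS.
  + by rewrite -[RHS]Sfull; apply: eq_bigr => i _.
  + by have [? ->] := evE i.
- move=> i j eij; apply: Sinj; rewrite -!ES.
  by have [_ ->] := evE i; have [_ ->] := evE j; rewrite eij.
Qed.

End Reversal.

Section Transport.
Set Implicit Arguments.
Unset Strict Implicit.
Variables (F : fieldType) (V : vectType F) (U : algType F) (rho : U -> 'End(V)).
Hypothesis rhoP : alg_module rho.
Implicit Types (x g : U) (a : F).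

Lemma alg_moduleB a x g : rho (a *: x - g) = a *: rho x - rho g.
Proof.
have [lin _ _] := rhoP.
have rho0 : rho 0 = 0.
  have := lin (-1) 0 0; rewrite scaler0 addr0 scaleN1r => e.
  by rewrite {1}e addNr.
have rhoN z : rho (- z) = - rho z.
  by have := lin (-1) z 0; rewrite !addr0 !scaleN1r rho0 addr0.
by rewrite lin rhoN.
Qed.

Lemma alg_module_left a x g : comm x (qcomm a x g) = 0 ->
  forall v, rho x (a *: rho x (rho g v) - rho g (rho x v))
  = a *: rho x (rho g (rho x v)) - rho g (rho x (rho x v)).
Proof.
have [_ _ mul] := rhoP.
move=> /eqP; rewrite subr_eq0 => /eqP /(congr1 rho); rewrite !mul alg_moduleB !mul.
by move=> /lfunP e v; have := e v; rewrite !lfun_simp.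
Qed.

Lemma alg_module_right a x g : comm x (qcomm a g x) = 0 ->
  forall v, rho x (a *: rho g (rho x v) - rho x (rho g v))
  = a *: rho g (rho x (rho x v)) - rho x (rho g (rho x v)).
Proof.
have [_ _ mul] := rhoP.
move=> /eqP; rewrite subr_eq0 => /eqP /(congr1 rho); rewrite !mul alg_moduleB !mul.
by move=> /lfunP e v; have := e v; rewrite !lfun_simp.
Qed.

End Transport.

Theorem theorem9p9
  (F : fieldType)
  (Fbar : closedFieldType) (iota : {rmorphism F -> Fbar})
  (hFbar : integralRange iota)
  (q : Fbar) (hq0 : q != 0)
  (hq : forall n : nat, (0 < n)%N -> q ^+ n != 1)
  (b : F) (hb : iota b = q ^+ 2)
  (V : vectType F) (hV : (fullv : {vspace V}) != 0%VS)
  (d : nat) (hd : (1 <= d)%N)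
  (A As : 'End(V)) (E Es : 'I_d.+1 -> 'End(V))
  (hPhi : TD_system A E As Es)
  (theta thetas : 'I_d.+1 -> F)
  (htheta : forall i, eigenvalue_for A (E i) (theta i))
  (hthetas : forall i, eigenvalue_for As (Es i) (thetas i))
  (hserre : q_Serre_type b theta thetas)
  (rho : Uqp b -> 'End(V)) (hrho : alg_module rho)
  (hW0 : rho (W0 b) = A) (hW1 : rho (W1 b) = As)
  (k : nat) :
  let G := rho (Uqp_G b k.+1) in
  let Gt := rho (Uqp_Gt b k.+1) in
  [/\ [/\ acts_lower G (dec_0_D E) /\ acts_raise Gt (dec_0_D E),
          acts_lower G (dec_0s_Ds Es) /\ acts_raise Gt (dec_0s_Ds Es)
        & acts_lower G (dec_0s_D E Es) /\ acts_raise Gt (dec_0s_D E Es)],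
      acts_diag G (dec_0s_0 E Es) /\ acts_tridiag Gt (dec_0s_0 E Es),
      acts_raise G (dec_Ds_0 E Es) /\ acts_lower Gt (dec_Ds_0 E Es)
    & acts_tridiag G (dec_Ds_D E Es) /\ acts_diag Gt (dec_Ds_D E Es)].
Proof.
have b0 : b != 0.
  by rewrite -(fmorph_eq0 iota) hb expf_neq0.
have b1 n : b ^+ n.+1 != 1.
  by rewrite -(inj_eq (fmorph_inj iota)) rmorphXn rmorph1 hb -exprM hq.
have [hTD [S ordS idemS] [Ss ordSs idemSs]] := hPhi.
have [efE thetaI tri] :=
  eigen_family_standard (TD_diagl hTD) ordS idemS htheta.
have [efEs thetasI tris] :=
  eigen_family_standard (TD_diagr hTD) ordSs idemSs hthetas.
have irr := TD_irr hTD.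
have thetaS (i j : 'I_d.+1) : j = i.+1 :> nat -> theta j = b * theta i.
  by move=> /hserre[].
have thetasS (i j : 'I_d.+1) : j = i.+1 :> nat -> thetas j = b^-1 * thetas i.
  by move=> /hserre[].
have bV0 : b^-1 != 0 by rewrite invr_eq0.
have bV1 n : b^-1 ^+ n.+1 != 1 by rewrite exprVn invr_eq1.
have serre0 : comm (W0 b) (qcomm b^-1 (W0 b) (qcomm b (W0 b) (W1 b))) = 0.
  exact: (Uqp_serre b false).
have serre1 : comm (W1 b) (qcomm b^-1 (W1 b) (qcomm b (W1 b) (W0 b))) = 0.
  exact: (Uqp_serre b true).
move=> G Gt.
have GE : acts_lower G (fun i => limg (E i)).
  apply: (acts_lower_geometric efE thetaI hd thetaS b0 b1).
  apply: (eigen_left_qcomm efE); rewrite -hW0.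
  exact (alg_module_left hrho (comm_W0_G b0 b1 serre0 serre1 k.+1)).
have GtE : acts_raise Gt (fun i => limg (E i)).
  apply: (acts_raise_geometric efE thetaI hd thetaS b0 b1).
  apply: (eigen_right_qcomm efE); rewrite -hW0.
  exact (alg_module_right hrho (comm_W0_Gt b0 b1 serre0 serre1 k.+1)).
have GEs : acts_lower G (fun i => limg (Es i)).
  apply: (acts_lower_geometric efEs thetasI hd thetasS bV0 bV1) => i j v vE Ev.
  have [|->|->] := eigen_right_qcomm (G := G) (b := b) efEs _ vE Ev.
  - rewrite -hW1.
    exact (alg_module_right hrho (comm_W1_G b0 b1 serre0 serre1 k.+1)).
  - by left.
  - by right; rewrite mulKf.
have GtEs : acts_raise Gt (fun i => limg (Es i)).
  apply: (acts_raise_geometric efEs thetasI hd thetasS bV0 bV1) => i j v vE Ev.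
  have [|->|<-] := eigen_left_qcomm (G := Gt) (b := b) efEs _ vE Ev.
  - rewrite -hW1.
    exact (alg_module_left hrho (comm_W1_Gt b0 b1 serre0 serre1 k.+1)).
  - by left.
  - by right; rewrite mulKf.
have efEr := eigen_family_rev efE; have efEsr := eigen_family_rev efEs.
have trir := acts_tridiag_rev tri; have trisr := acts_tridiag_rev tris.
have GEr := acts_lower_rev GE; have GtEr := acts_raise_rev GtE.
have GEsr := acts_lower_rev GEs; have GtEsr := acts_raise_rev GtEs.
rewrite dec_0s_0E dec_Ds_0E dec_Ds_DE; split; [split|..]; split=> //.
- exact: (split_lower efE efEs).
- exact: (split_raise efE efEs).
- exact: (split_diag GEs GEr).
- exact: (split_tridiag efEr efEs).
- exact: (split_raise efEr efEsr).
- exact: (split_lower efEr efEsr).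
- exact: (split_tridiag efE efEsr).
- exact: (split_diag GtEsr GtE).
Qed.
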